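(* Let $v_+,v_->0$ and $\lambda_+,\lambda_->0$. In the steady state of the unit-age process driven by dichotomous Markov noise, the unit age is exponentially distributed: its probability density function $f=P_++P_-$ is $$f(x)=\frac{1}{\Lambda}e^{-x/\Lambda},\qquad x\ge 0,$$ and its mean is $$\Lambda=\frac{v_+v_-}{v_-\lambda_+-v_+\lambda_-}.$$
   Context: Dichotomous Markov noise (DMN) is a two-state process $v(t)$. In the $+$ state the unit age increases at rate $v_+$; in the $-$ state it decreases at rate $v_-$. The transition frequency out of the $+$ state is $\lambda_+$ and out of the $-$ state is $\lambda_-$. Let $P_\pm(x,t)$ be the density of the unit age at $x\ge 0$ at time $t$ with the noise in state $\pm$. These evolve according to $$\frac{\partial P_+}{\partial t}=-v_+\frac{\partial P_+}{\partial x}-\lambda_+P_++\lambda_-P_-,\qquad \frac{\partial P_-}{\partial t}=\lambda_+P_++v_-\frac{\partial P_-}{\partial x}-\lambda_-P_-.$$ A steady state is a time-independent solution $P_\pm(x)$ (continuously differentiable on $[0,\infty)$) of this system, that is, $$P_+'=-\frac{\lambda_+}{v_+}P_++\frac{\lambda_-}{v_+}P_-,\qquad P_-'=-\frac{\lambda_+}{v_-}P_++\frac{\lambda_-}{v_-}P_-,$$ satisfying $\lim_{x\to\infty}P_\pm(x)=0$ and such that the total density $f=P_++P_-$ satisfies $\int_0^\infty f(x)\,dx=1$. *)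

(* Defs.v *)
From Stdlib Require Import Reals.
From Coquelicot Require Import Coquelicot.

Open Scope R_scope.

(** Functions on [0,oo) are total functions on [R]; everything below constrains
    only their values at nonnegative arguments. *)
Definition nonneg_half_line (y : R) : Prop := 0 <= y.

(** Derivatives are taken relative to [0,oo) ([D_in]), so they are two-sided at
    positive points and right derivatives at 0. *)
Definition C1_half_line (g : R -> R) : Prop :=
  exists dg : R -> R, forall x : R, 0 <= x ->
    D_in g dg nonneg_half_line x /\ continue_in dg nonneg_half_line x.

(** [Pp x t] and [Pm x t] are the densities of the unit age at [x] at time [t]
    with the noise in the + and - state; times range over [0,oo) as well. *)
Definition dmn_evolution (vp vm lp lm : R) (Pp Pm : R -> R -> R) : Prop :=
  exists dtPp dtPm dxPp dxPm : R -> R -> R,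
    forall x t : R, 0 <= x -> 0 <= t ->
      D_in (fun s => Pp x s) (fun s => dtPp x s) nonneg_half_line t /\
      D_in (fun s => Pm x s) (fun s => dtPm x s) nonneg_half_line t /\
      D_in (fun y => Pp y t) (fun y => dxPp y t) nonneg_half_line x /\
      D_in (fun y => Pm y t) (fun y => dxPm y t) nonneg_half_line x /\
      dtPp x t = - vp * dxPp x t - lp * Pp x t + lm * Pm x t /\
      dtPm x t = lp * Pp x t + vm * dxPm x t - lm * Pm x t.

Definition total_density (Pp Pm : R -> R) (x : R) : R := Pp x + Pm x.

Definition is_integral_half_line (g : R -> R) (I : R) : Prop :=
  is_RInt_gen g (at_point 0) (Rbar_locally p_infty) I.

Definition is_mean (f : R -> R) (m : R) : Prop :=
  is_integral_half_line (fun x => x * f x) m.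

Record dmn_steady_state (vp vm lp lm : R) (Pp Pm : R -> R) : Prop := {
  steady_C1_p : C1_half_line Pp;
  steady_C1_m : C1_half_line Pm;
  steady_evolution :
    dmn_evolution vp vm lp lm (fun x _ => Pp x) (fun x _ => Pm x);
  steady_lim_p : is_lim Pp p_infty 0;
  steady_lim_m : is_lim Pm p_infty 0;
  steady_mass : is_integral_half_line (total_density Pp Pm) 1
}.

(* Main.v *)
Require Import Defs.
From Stdlib Require Import Reals Lra.
From Coquelicot Require Import Coquelicot.

Open Scope R_scope.

(** The two right-hand sides of the stationary system are proportional:
    [vp * Pp' = vm * Pm' = - lp * Pp + lm * Pm].  Hence the probability flux
    [vp * Pp - vm * Pm] is constant, and it vanishes because both densities
    tend to 0.  Substituting [Pm = vp / vm * Pp] leaves the single equation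
    [Pp' = - k * Pp] with [k = lp / vp - lm / vm = 1 / Lambda], so the total
    density is [C * exp (- k * x)].

    The sign of [k] is a conclusion, not a hypothesis.  A unit mass forces
    [C <> 0], and then [k <= 0] would keep the density away from 0 at infinity.
    With [k > 0] the mass is [C / k], so [C = k], and the mean is [1 / k].

    Derivatives are one-sided at 0, whereas the mean value theorem used here
    wants functions continuous on a whole neighbourhood.  So the argument runs
    on the extensions [fun y => P (Rmax y 0)], which are continuous at 0 and
    two-sided differentiable at positive points. *)

Lemma derive_in_half_line_interior (g dg : R -> R) (x : R) :
  0 < x -> D_in g dg nonneg_half_line x -> is_derive g x (dg x).
Proof.
  intros hx hD. apply is_derive_Reals. intros eps heps.
  destruct (hD eps heps) as [d [hd H]].
  assert (hm : 0 < Rmin d x) by (apply Rmin_pos; lra).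
  exists (mkposreal _ hm). intros h hh hlt. simpl in hlt.
  pose proof (Rmin_l d x). pose proof (Rmin_r d x).
  apply Rabs_def2 in hlt as hlt'.
  specialize (H (x + h)). simpl in H. unfold Rdist in H.
  replace (x + h - x) with h in H by ring.
  apply H. unfold D_x, nonneg_half_line.
  repeat split; lra.
Qed.

Lemma extension_eq (g : R -> R) (x : R) : 0 <= x -> g (Rmax x 0) = g x.
Proof. intros hx. now rewrite Rmax_left. Qed.

Lemma extension_is_derive (g dg : R -> R) (x : R) :
  0 < x -> D_in g dg nonneg_half_line x ->
  is_derive (fun y => g (Rmax y 0)) x (dg x).
Proof.
  intros hx hD. apply is_derive_ext_loc with g.
  - exists (mkposreal x hx). intros y hy.
    change (Rabs (y - x) < x) in hy. apply Rabs_def2 in hy.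
    symmetry. apply extension_eq. lra.
  - now apply derive_in_half_line_interior.
Qed.

Lemma extension_continuity (g dg : R -> R) (x : R) :
  0 <= x -> D_in g dg nonneg_half_line x ->
  continuity_pt (fun y => g (Rmax y 0)) x.
Proof.
  intros hx hD. apply cont_deriv in hD.
  intros eps heps. destruct (hD eps heps) as [d [hd H]].
  exists d. split; [exact hd|]. intros y [_ hy].
  simpl in *. unfold Rdist in *. rewrite (extension_eq g x hx).
  destruct (Req_dec (Rmax y 0) x) as [e|ne].
  - rewrite e, Rminus_diag, Rabs_R0. lra.
  - apply H. split.
    + split; [apply Rmax_r | now apply not_eq_sym].
    + (* truncation at 0 is 1-Lipschitz *)
      apply Rle_lt_trans with (2 := hy).
      unfold Rmax, Rabs.
      destruct (Rle_dec y 0); repeat destruct Rcase_abs; lra.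
Qed.

Lemma constant_of_zero_derive (g : R -> R) :
  (forall x, 0 < x -> is_derive g x 0) ->
  (forall x, 0 <= x -> continuity_pt g x) ->
  forall x, 0 <= x -> g x = g 0.
Proof.
  intros hd hc x hx.
  destruct (MVT_gen g 0 x (fun _ => 0)) as [c [_ hcx]].
  - intros y hy. rewrite Rmin_left in hy by lra. apply hd; lra.
  - intros y hy. rewrite Rmin_left in hy by lra. apply hc; lra.
  - lra.
Qed.

(** Multiplying by the integrating factor [exp (k * x)] gives a constant. *)
Lemma exponential_of_linear_ode (g : R -> R) (k : R) :
  (forall x, 0 < x -> is_derive g x (- k * g x)) ->
  (forall x, 0 <= x -> continuity_pt g x) ->
  forall x, 0 <= x -> g x = g 0 * exp (- k * x).
Proof.
  intros hd hc x hx.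
  assert (E : forall y, is_derive (fun z => exp (k * z)) y (k * exp (k * y))).
  { intros y. auto_derive; [exact I | ring]. }
  assert (H : g x * exp (k * x) = g 0 * exp (k * 0)).
  { apply (constant_of_zero_derive (fun y => g y * exp (k * y))); [| |exact hx].
    - intros y hy.
      evar_last.
      + apply (is_derive_mult g (fun z => exp (k * z)) y).
        * now apply hd.
        * apply E.
        * intros; apply Rmult_comm.
      + unfold plus, mult; simpl. ring.
    - intros y hy. apply continuity_pt_mult; [now apply hc|].
      apply derivable_continuous_pt. exists (k * exp (k * y)).
      apply is_derive_Reals, E. }
  rewrite Rmult_0_r, exp_0, Rmult_1_r in H.
  rewrite <- H, Rmult_assoc, <- exp_plus.
  replace (k * x + - k * x) with 0 by ring. rewrite exp_0. ring.
Qed.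

(** The fundamental theorem of calculus on [0,oo): the integrand need agree with
    the derivative of [G] at nonnegative points only. *)
Lemma integral_half_line_of_antiderivative (g g0 G : R -> R) (L : R) :
  (forall x, 0 <= x -> g x = g0 x) ->
  (forall x, is_derive G x (g0 x)) ->
  (forall x, continuous g0 x) ->
  is_lim G p_infty L ->
  is_integral_half_line g (L - G 0).
Proof.
  intros hg hG hc hL P hP.
  assert (hlim : is_lim (fun b => G b - G 0) p_infty (L - G 0)).
  { apply is_lim_minus'; [exact hL | apply is_lim_const]. }
  destruct (hlim P hP) as [M hM].
  apply Filter_prod with (Q := fun a => a = 0)
                         (R := fun b => Rmax M 0 < b).
  - reflexivity.
  - now exists (Rmax M 0).
  - intros a b -> hb. exists (G b - G 0). simpl.
    pose proof (Rmax_l M 0). pose proof (Rmax_r M 0). split.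
    + apply is_RInt_ext with g0.
      * intros x hx. rewrite Rmin_left in hx by lra. symmetry. apply hg. lra.
      * apply (is_RInt_derive G g0); auto.
    + apply hM. lra.
Qed.

Lemma integral_half_line_unique (g : R -> R) (I J : R) :
  is_integral_half_line g I -> is_integral_half_line g J -> I = J.
Proof.
  unfold is_integral_half_line. intros hI hJ.
  rewrite <- (is_RInt_gen_unique g I hI). exact (is_RInt_gen_unique g J hJ).
Qed.

Lemma is_lim_opp_scal_p_infty (k : R) :
  0 < k -> is_lim (fun x => - k * x) p_infty m_infty.
Proof.
  intros hk.
  evar_last.
  - apply is_lim_scal_l, is_lim_id.
  - simpl. destruct (Rle_dec 0 (- k)); [exfalso; lra | reflexivity].
Qed.

Lemma is_lim_exp_decay (k : R) :
  0 < k -> is_lim (fun x => exp (- k * x)) p_infty 0.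
Proof.
  intros hk. apply is_lim_comp with m_infty.
  - apply is_lim_exp_m.
  - now apply is_lim_opp_scal_p_infty.
  - exists 0. intros y _. discriminate.
Qed.

Lemma is_lim_mul_exp_decay (k : R) :
  0 < k -> is_lim (fun x => x * exp (- k * x)) p_infty 0.
Proof.
  intros hk.
  apply is_lim_ext with (fun x => - / k * ((- k * x) * exp (- k * x))).
  { intros x. field. lra. }
  replace 0 with (- / k * 0) by ring.
  apply (is_lim_scal_l _ (- / k) p_infty 0).
  apply (is_lim_comp (fun y => y * exp y) (fun x => - k * x) p_infty 0 m_infty).
  - apply is_lim_mul_exp_m.
  - now apply is_lim_opp_scal_p_infty.
  - exists 0. intros y _. discriminate.
Qed.

Lemma exponential_mass (g : R -> R) (C k : R) :
  0 < k -> (forall x, 0 <= x -> g x = C * exp (- k * x)) ->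
  is_integral_half_line g (C / k).
Proof.
  intros hk hg.
  replace (C / k) with (- C / k * 0 - - C / k * exp (- k * 0)).
  2: { rewrite (Rmult_0_r (- k)), exp_0. field. lra. }
  apply (integral_half_line_of_antiderivative
           g (fun x => C * exp (- k * x)) (fun x => - C / k * exp (- k * x)));
    [exact hg | | |].
  - intros x. auto_derive; [exact I | field; lra].
  - intros x. apply (ex_derive_continuous (fun x => C * exp (- k * x))).
    auto_derive. exact I.
  - apply (is_lim_scal_l _ (- C / k) p_infty 0). now apply is_lim_exp_decay.
Qed.

Lemma exponential_mean (g : R -> R) (k : R) :
  0 < k -> (forall x, 0 <= x -> g x = k * exp (- k * x)) ->
  is_mean g (/ k).
Proof.
  intros hk hg. unfold is_mean.
  set (G := fun x => - 1 * (x * exp (- k * x)) + - / k * exp (- k * x)).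
  replace (/ k) with ((-1 * 0 + - / k * 0) - G 0).
  2: { unfold G. rewrite (Rmult_0_r (- k)), exp_0. ring. }
  apply integral_half_line_of_antiderivative
    with (fun x => x * (k * exp (- k * x))).
  - intros x hx. now rewrite hg.
  - intros x. unfold G. auto_derive; [exact I | field; lra].
  - intros x. apply (ex_derive_continuous (fun x => x * (k * exp (- k * x)))).
    auto_derive. exact I.
  - apply is_lim_plus'.
    + apply (is_lim_scal_l _ (-1) p_infty 0). now apply is_lim_mul_exp_decay.
    + apply (is_lim_scal_l _ (- / k) p_infty 0). now apply is_lim_exp_decay.
Qed.

(** A vanishing amplitude contradicts the unit mass; with a nonzero amplitude,
    [k <= 0] would give [Rabs C <= Rabs (g x)] for all [x >= 0]. *)
Lemma exponential_rate_pos (g : R -> R) (C k : R) :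
  (forall x, 0 <= x -> g x = C * exp (- k * x)) ->
  is_lim g p_infty 0 -> is_integral_half_line g 1 -> 0 < k.
Proof.
  intros hg hlim hmass.
  destruct (Rlt_le_dec 0 k) as [hk|hk]; [exact hk|exfalso].
  assert (hC : Rabs C <= 0).
  { apply (is_lim_le_loc (fun _ => Rabs C) (fun x => Rabs (g x)) p_infty
             (Rabs C) 0).
    - exists 0. intros x hx. rewrite hg by lra.
      rewrite Rabs_mult, (Rabs_right (exp _)) by (left; apply exp_pos).
      rewrite <- (Rmult_1_r (Rabs C)) at 1.
      apply Rmult_le_compat_l; [apply Rabs_pos|].
      pose proof (exp_ineq1_le (- k * x)). nra.
    - apply is_lim_const.
    - pose proof (is_lim_Rabs g p_infty 0 hlim) as habs. simpl in habs.
      now rewrite Rabs_R0 in habs. }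
  assert (C = 0) as ->.
  { pose proof (Rabs_pos C). destruct (Req_dec C 0) as [e|e]; [exact e|].
    apply Rabs_pos_lt in e. lra. }
  (* with amplitude 0 the rate is arbitrary, and 1 is a positive one *)
  assert (H0 : is_integral_half_line g (0 / 1)).
  { apply exponential_mass; [lra|]. intros x hx. rewrite hg by lra. ring. }
  pose proof (integral_half_line_unique _ _ _ hmass H0). lra.
Qed.

(** A derivative of the constant path [fun s => P x], taken at an interior time,
    vanishes; this turns the evolution equations into the stationary system. *)
Lemma stationary_system (vp vm lp lm : R) (Pp Pm : R -> R) :
  dmn_evolution vp vm lp lm (fun x _ => Pp x) (fun x _ => Pm x) ->
  exists dPp dPm : R -> R, forall x, 0 <= x ->
    D_in Pp dPp nonneg_half_line x /\ D_in Pm dPm nonneg_half_line x /\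
    vp * dPp x = - lp * Pp x + lm * Pm x /\
    vm * dPm x = - lp * Pp x + lm * Pm x.
Proof.
  intros (dtPp & dtPm & dxPp & dxPm & H).
  exists (fun x => dxPp x 1), (fun x => dxPm x 1). intros x hx.
  destruct (H x 1 hx Rle_0_1) as (h1 & h2 & h3 & h4 & h5 & h6).
  apply derive_in_half_line_interior, is_derive_unique in h1, h2; try lra.
  rewrite Derive_const in h1, h2.
  repeat split; [exact h3 | exact h4 | lra | lra].
Qed.

(** The constant value of the flux [vp * Pp - vm * Pm] is its limit, 0. *)
Lemma zero_flux (vp vm lp lm : R) (Pp Pm dPp dPm : R -> R) :
  (forall x, 0 <= x ->
    D_in Pp dPp nonneg_half_line x /\ D_in Pm dPm nonneg_half_line x /\
    vp * dPp x = - lp * Pp x + lm * Pm x /\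
    vm * dPm x = - lp * Pp x + lm * Pm x) ->
  is_lim Pp p_infty 0 -> is_lim Pm p_infty 0 ->
  forall x, 0 <= x -> vp * Pp x = vm * Pm x.
Proof.
  intros H hlp hlm.
  set (J := fun y => vp * Pp (Rmax y 0) - vm * Pm (Rmax y 0)).
  assert (hJ : forall x, 0 <= x -> J x = J 0).
  { apply constant_of_zero_derive.
    - intros x hx. destruct (H x (Rlt_le _ _ hx)) as (h1 & h2 & h3 & h4).
      evar_last.
      + apply (is_derive_minus (fun y => vp * Pp (Rmax y 0))
                               (fun y => vm * Pm (Rmax y 0)));
          apply is_derive_scal; apply extension_is_derive; eassumption.
      + unfold minus, plus, opp; simpl. lra.
    - intros x hx. destruct (H x hx) as (h1 & h2 & _).
      apply continuity_pt_minus; apply continuity_pt_scal;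
        eapply extension_continuity; eassumption. }
  assert (hJ0 : J 0 = 0).
  { assert (h0 : is_lim J p_infty 0).
    { apply is_lim_ext_loc with (fun y => vp * Pp y - vm * Pm y).
      - exists 0. intros y hy. unfold J. now rewrite !extension_eq by lra.
      - replace 0 with (vp * 0 - vm * 0) by ring.
        apply is_lim_minus';
          [ apply (is_lim_scal_l _ vp p_infty 0 hlp)
          | apply (is_lim_scal_l _ vm p_infty 0 hlm) ]. }
    assert (h1 : is_lim J p_infty (J 0)).
    { apply is_lim_ext_loc with (fun _ => J 0).
      - exists 0. intros y hy. symmetry. apply hJ. lra.
      - apply is_lim_const. }
    apply is_lim_unique in h0, h1. congruence. }
  intros x hx. pose proof (hJ x hx) as e. rewrite hJ0 in e.
  unfold J in e. rewrite !extension_eq in e by exact hx. lra.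
Qed.

Theorem lemma1p4 (vp vm lp lm : R)
    (hvp : 0 < vp) (hvm : 0 < vm) (hlp : 0 < lp) (hlm : 0 < lm)
    (Pp Pm : R -> R) (hst : dmn_steady_state vp vm lp lm Pp Pm) :
  let f := total_density Pp Pm in
  let Lambda := vp * vm / (vm * lp - vp * lm) in
  0 < Lambda /\
  (forall x : R, 0 <= x -> f x = 1 / Lambda * exp (- x / Lambda)) /\
  is_mean f Lambda.
Proof.
  intros f Lambda. destruct hst as [_ _ hev limp limm hmass].
  destruct (stationary_system _ _ _ _ _ _ hev) as (dPp & dPm & H).
  pose proof (zero_flux _ _ _ _ _ _ _ _ H limp limm) as hflux.
  set (k := lp / vp - lm / vm).
  assert (hPp : forall x, 0 <= x -> Pp x = Pp 0 * exp (- k * x)).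
  { intros x hx.
    pose proof (exponential_of_linear_ode (fun y => Pp (Rmax y 0)) k) as E.
    rewrite <- (extension_eq Pp x hx), <- (extension_eq Pp 0 (Rle_refl 0)).
    apply E; [| |exact hx]; clear x hx E; intros x hx.
    - assert (hx' : 0 <= x) by lra.
      destruct (H x hx') as (h1 & _ & h3 & _).
      rewrite extension_eq by exact hx'.
      replace (- k * Pp x) with (dPp x).
      + now apply extension_is_derive.
      + specialize (hflux x hx').
        assert (e : Pm x = vp * Pp x / vm) by (rewrite hflux; field; lra).
        rewrite e in h3. apply Rmult_eq_reg_l with vp; [|lra].
        rewrite h3. unfold k. field. lra.
    - destruct (H x hx) as (h1 & _).
      eapply extension_continuity; eassumption. }
  set (C := (1 + vp / vm) * Pp 0).
  assert (hf : forall x, 0 <= x -> f x = C * exp (- k * x)).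
  { intros x hx. unfold f, total_density.
    assert (e : Pm x = vp * Pp x / vm) by (rewrite (hflux x hx); field; lra).
    rewrite e, (hPp x hx). unfold C. field. lra. }
  assert (hlim : is_lim f p_infty 0).
  { replace 0 with (0 + 0) by ring. now apply is_lim_plus'. }
  pose proof (exponential_rate_pos f C k hf hlim hmass) as hk.
  assert (hCk : C = k).
  { pose proof (integral_half_line_unique _ _ _ hmass
                  (exponential_mass f C k hk hf)) as e.
    apply Rmult_eq_reg_r with (/ k); [|apply Rinv_neq_0_compat; lra].
    rewrite Rinv_r by lra. symmetry. exact e. }
  rewrite hCk in hf.
  assert (hL : Lambda = / k).
  { assert (hden : vm * lp - vp * lm = k * (vp * vm)) by (unfold k; field; lra).
    unfold Lambda. rewrite hden. field. lra. }
  rewrite hL. split; [|split].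
  - now apply Rinv_0_lt_compat.
  - intros x hx. rewrite (hf x hx).
    replace (- x / / k) with (- k * x) by (field; lra).
    field. lra.
  - now apply exponential_mean.
Qed.
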